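(* Let $\epsilon>0$ and $\zeta>1$ be real. If $\zeta\geq 1+\frac{1}{2\epsilon}$, then $\varpi_{\epsilon,\zeta}$ is dense in $\mathbb{R}$. If $\zeta\geq 1+\frac1\epsilon$, then for any real $b>a$ the set $\varpi_{\epsilon,\zeta}\cap(a,b)$ has the cardinality of $\mathbb{R}$.
   Context: For real $x$, $\Vert x\Vert$ denotes the distance from $x$ to the nearest integer. For real $\zeta>1$ and $\epsilon>0$, let $\varpi_{\epsilon,\zeta}$ be the set of all real $\alpha\neq 0$ such that $\Vert\alpha\zeta^n\Vert\leq\epsilon$ for all integers $n\geq n_0$, for some integer $n_0=n_0(\alpha,\zeta,\epsilon)$. *)

(* Defs.v *)
From HB Require Import structures.
From mathcomp Require Import all_boot all_order all_algebra.
From mathcomp Require Import all_classical all_reals all_analysis.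

Set Implicit Arguments.
Unset Strict Implicit.
Unset Printing Implicit Defensive.

Import Order.TTheory GRing.Theory Num.Theory.
Import numFieldNormedType.Exports.

Local Open Scope classical_set_scope.
Local Open Scope ring_scope.

(* The set is nonempty and bounded below by 0, so [inf] is its genuine infimum;
   it is attained at the integers nearest to [x]. *)
Definition dist_int (R : realType) (x : R) : R :=
  inf [set `|x - m%:~R| | m in [set: int]].

Definition varpi (R : realType) (epsilon zeta : R) : set R :=
  [set alpha | alpha != 0 /\
     exists n0 : int, forall n : int, n0 <= n ->
       dist_int (alpha * zeta ^ n) <= epsilon].

(* Main.v *)
Require Import Defs.
From HB Require Import structures.
From mathcomp Require Import all_boot all_order all_algebra.
From mathcomp Require Import all_classical all_reals all_analysis.
From mathcomp Require Import lra.

(** For a real [alpha] within [epsilon] of an integer [m] after multiplication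
    by [zeta ^ n], the condition confines [alpha] to a closed interval of length
    [2 epsilon / zeta ^ n].  The intervals of the next level, of length
    [2 epsilon / zeta ^ n.+1], have centres spaced by [zeta ^- n.+1], so at
    least one of them is nested in it if [1 <= 2 epsilon (zeta - 1)], and at
    least two if [2 <= 2 epsilon (zeta - 1)].  In the second case every 0-1
    sequence selects a point; for [epsilon < 1/2] the intervals of one level are
    disjoint, so different sequences select different points.  For
    [1/2 <= epsilon] every nonzero real qualifies. *)

Import Order.TTheory GRing.Theory Num.Theory.
Import numFieldNormedType.Exports.

Local Open Scope classical_set_scope.
Local Open Scope ring_scope.

Section dist_int.
Variable R : realType.
Implicit Types x : R.

Lemma dist_int_le x (m : int) : dist_int x <= `|x - m%:~R|.
Proof.
apply: ge_inf; last by exists m.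
by exists 0 => _ [k _ <-]; exact: normr_ge0.
Qed.

Lemma dist_int_le_half x : dist_int x <= 1 / 2.
Proof.
apply: le_trans (dist_int_le x (Num.floor (x + 1 / 2))) _.
have := floor_itv (x + 1 / 2); rewrite intrD => /andP[h1 h2].
by rewrite ler_norml; apply/andP; split; lra.
Qed.

Lemma varpi_near_int (epsilon zeta alpha : R) (n : nat) (N : nat -> int) :
  alpha != 0 ->
  (forall k, `|alpha * zeta ^+ (n + k) - (N k)%:~R| <= epsilon) ->
  varpi epsilon zeta alpha.
Proof.
move=> alpha0 hN; split=> //; exists n%:Z; case=> // p; rewrite lez_nat => np.
rewrite -exprnP -(subnKC np).
exact: le_trans (dist_int_le _ _) (hN _).
Qed.

Lemma varpi_half_le (epsilon zeta : R) :
  1 / 2 <= epsilon -> varpi epsilon zeta = [set alpha | alpha != 0].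
Proof.
move=> e2; apply/seteqP; split=> [alpha []//|alpha alpha0]; split=> //.
by exists 0 => n _; apply: le_trans (dist_int_le_half _) e2.
Qed.

End dist_int.

Lemma bernoulli_ineq {R : realDomainType} (z : R) (n : nat) :
  1 <= z -> 1 + (z - 1) *+ n <= z ^+ n.
Proof.
move=> z1; elim: n => [|n IHn]; first by rewrite mulr0n addr0 expr0.
have : 1 <= z ^+ n by exact: exprn_ege1.
rewrite mulrSr exprS; nra.
Qed.

(** The supremum of the left endpoints is such a point: comparison at the larger of two indices puts
    every [l k] below every [u j]. *)
Lemma nested_intervals {R : realType} (l u : nat -> R) :
  nondecreasing_seq l -> nonincreasing_seq u -> (forall k, l k <= u k) ->
  exists x, forall k, l k <= x <= u k.
Proof.
move=> lnd uni lu.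
have lku j k : l k <= u j.
  apply: le_trans (lnd _ _ (leq_maxr j k)) _.
  exact: le_trans (lu _) (uni _ _ (leq_maxl j k)).
exists (sup (range l)) => k; apply/andP; split.
  by apply: ub_le_sup; [exists (u 0%N) => _ [j _ <-] | exists k].
by apply: ge_sup; [exists (l 0%N), 0%N | move=> _ [j _ <-]].
Qed.

Lemma start_interval {R : realType} (epsilon zeta a b : R) :
  0 < epsilon -> 1 < zeta -> a < b ->
  exists (n : nat) (m : int), forall alpha,
    `|alpha * zeta ^+ n - m%:~R| <= epsilon -> alpha != 0 /\ a < alpha < b.
Proof.
move=> e0 z1 ab.
(* The open interval from [c] to [b] lies on one side of 0, which will give [alpha != 0]. *)
have [c [ac cb c0]] : exists c, [/\ a <= c, c < b & 0 <= c \/ b <= 0].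
  have [b0|b0] := leP b 0; first by exists a; split=> //; right.
  exists (Num.max a 0); rewrite le_max lexx gt_max ab b0.
  by split=> //; left; rewrite le_max lexx orbT.
have d0 : 0 < b - c by lra.
(* By Bernoulli, any [n] above this quotient gives [epsilon + 1 < (b - c) / 2 * zeta ^+ n]: room
   around the scaled midpoint for the tolerance [epsilon] and for an error below 1 from rounding
   down. *)
have q0 : 0 <= (epsilon + 1) / ((b - c) / 2 * (zeta - 1)).
  by rewrite divr_ge0 ?mulr_ge0 //; lra.
have := archi_boundP q0; set n := Num.bound _.
rewrite ltr_pdivrMr; last by nra.
move=> hn; exists n, (Num.floor ((c + b) / 2 * zeta ^+ n)) => alpha halpha.
have := bernoulli_ineq zeta n (ltW z1); rewrite -mulr_natr => hz.
have := floor_itv ((c + b) / 2 * zeta ^+ n); rewrite intrD => /andP[f1 f2].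
move: halpha f1 f2; rewrite ler_norml => /andP[]; move: hz.
set Z := zeta ^+ n; set f := (_)%:~R => hz h1 h2 f1 f2.
have Z0 : 0 < Z by apply: exprn_gt0; lra.
have hZ : epsilon + 1 < (b - c) / 2 * Z by nra.
have ca : c < alpha by rewrite -(ltr_pM2r Z0); nra.
have ba : alpha < b by rewrite -(ltr_pM2r Z0); nra.
split; last by apply/andP; split; lra.
by case: c0 => ?; [apply: lt0r_neq0 | apply: ltr0_neq0]; lra.
Qed.

Section digit_expansion.
Context {R : realType}.
Variables (epsilon zeta : R).
Implicit Types (d : nat -> bool) (m : int).

(* [digit_centre d m k / zeta ^ (n + k)] is the centre of the k-th nested
   interval; the ceiling is the leftmost admissible choice. *)
Fixpoint digit_centre d m k : int :=
  if k is k'.+1 then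
    Num.ceil (zeta * ((digit_centre d m k')%:~R - epsilon) + epsilon)
      + (d k' : nat)%:Z
  else m.

(** Nesting requires the next centre to lie between [zeta * (N k - epsilon) + epsilon] and
    [zeta * (N k + epsilon) - epsilon]. This range has length [2 * epsilon * (zeta - 1)], at least
    [1 + d k], so the ceiling of its left end, shifted by [d k], stays inside. *)
Lemma digit_expansion d m (n : nat) :
  0 < epsilon -> 1 < zeta ->
  (forall k, 1 + (d k)%:R <= 2 * epsilon * (zeta - 1)) ->
  exists alpha, forall k,
    `|alpha * zeta ^+ (n + k) - (digit_centre d m k)%:~R| <= epsilon.
Proof.
move=> e0 z1 hd; pose N k : R := (digit_centre d m k)%:~R.
have Zgt0 k : 0 < zeta ^+ k by rewrite exprn_gt0 ?(lt_trans ltr01).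
have step k : zeta * (N k - epsilon) <= N k.+1 - epsilon /\
              N k.+1 + epsilon <= zeta * (N k + epsilon).
  have := ceil_itv (zeta * (N k - epsilon) + epsilon).
  have := hd k; have : 0 <= (d k)%:R :> R by exact: ler0n.
  rewrite [N k.+1]/N /= -/(N k) intrB intrD -!pmulrn => d0 h /andP[c1 c2].
  by split; nra.
have [|||x hx] := @nested_intervals R
    (fun k => (N k - epsilon) / zeta ^+ (n + k))
    (fun k => (N k + epsilon) / zeta ^+ (n + k)).
- apply/nondecreasing_seqP => k; have [h _] := step k.
  rewrite addnS exprS invfM mulrA ler_pM2r ?invr_gt0 //.
  by rewrite ler_pdivlMr ?(lt_trans ltr01) // mulrC.
- apply/nonincreasing_seqP => k; have [_ h] := step k.
  rewrite addnS exprS invfM mulrA ler_pM2r ?invr_gt0 //.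
  by rewrite ler_pdivrMr ?(lt_trans ltr01) // mulrC.
- by move=> k; rewrite ler_pM2r ?invr_gt0 //; lra.
exists x => k; have := hx k.
rewrite ler_pdivrMr // ler_pdivlMr // ler_norml -/(N k) => /andP[h1 h2].
by apply/andP; split; lra.
Qed.

(** Two integers within [epsilon < 1 / 2] of the same real are less than 1 apart, so the two
    sequences of centres coincide. *)
Lemma digit_expansion_inj d d' m (n : nat) (alpha : R) : epsilon < 1 / 2 ->
  (forall k, `|alpha * zeta ^+ (n + k) - (digit_centre d m k)%:~R|
             <= epsilon) ->
  (forall k, `|alpha * zeta ^+ (n + k) - (digit_centre d' m k)%:~R|
             <= epsilon) ->
  d =1 d'.
Proof.
move=> e2 h h' k.
have NN j : digit_centre d m j = digit_centre d' m j.
  apply/eqP; rewrite -subr_eq0 -normr_le0 -ltzD1 add0r -(ltr_int R) intr_norm.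
  rewrite intrB; move: (h j) (h' j).
  rewrite !ler_norml ltr_norml => /andP[? ?] /andP[? ?].
  by apply/andP; split; lra.
(* Equal centres at level [k] have equal ceilings at the next level; these cancel and leave the
   digits. *)
have := NN k.+1; rewrite /= NN => /addrI [].
by case: (d k) (d' k) => [] [].
Qed.

Lemma varpi_meets_itv (a b : R) :
  0 < epsilon -> 1 < zeta -> 1 + 1 / (2 * epsilon) <= zeta -> a < b ->
  exists2 alpha, varpi epsilon zeta alpha & a < alpha < b.
Proof.
move=> e0 z1 hz ab.
have [n [m nm]] := start_interval epsilon zeta a b e0 z1 ab.
(* With all digits 0, the condition on [zeta] becomes [1 <= 2 * epsilon * (zeta - 1)]. *)
have [|alpha halpha] := digit_expansion (fun=> false) m n e0 z1.
  move=> _; move: hz; rewrite -lerBrDl ler_pdivrMr; last by lra.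
  by rewrite addr0; lra.
have [|alpha0 ?] := nm alpha; first by rewrite -[n]addn0; exact: (halpha 0%N).
by exists alpha => //; exact: varpi_near_int halpha.
Qed.

End digit_expansion.

Lemma card_le_inj {T U : Type} (A : set T) (B : set U) (f : T -> U) :
  {in A &, injective f} -> f @` A `<=` B -> (A #<= B)%card.
Proof.
move=> finj fAB; apply: card_le_trans (subset_card_le fAB).
by move: (inj_card_eq finj); rewrite card_eq_le => /andP[].
Qed.

(* A real is coded by its Dedekind cut. *)
Lemma real_card_le_cantor (R : realType) :
  ([set: R] #<= [set: nat -> bool])%card.
Proof.
pose f (x : R) (n : nat) : bool :=
  if unpickle n is Some q then ratr q < x else false.
apply: (card_le_inj _ _ f) => // x y _ _ fxy.
wlog xy : x y fxy / x < y => [wl|].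
  by have [xy|xy|//] := ltgtP x y; [|apply/esym]; apply: wl.
have [q] := rat_in_itvoo xy; rewrite in_itv /= => /andP[xq qy].
have := congr1 (@^~ (pickle q)) fxy.
by rewrite /f pickleK qy ltNge (ltW xq).
Qed.

Lemma real_card_le_varpi_itv_lt_half {R : realType} (epsilon zeta a b : R) :
  0 < epsilon < 1 / 2 -> 1 < zeta -> 1 + 1 / epsilon <= zeta -> a < b ->
  ([set: R] #<= varpi epsilon zeta `&` `]a, b[)%card.
Proof.
move=> /andP[e0 e2] z1 hz ab; apply: card_le_trans (real_card_le_cantor R) _.
have [n [m nm]] := start_interval epsilon zeta a b e0 z1 ab.
have hd (d : nat -> bool) k : 1 + (d k)%:R <= 2 * epsilon * (zeta - 1).
  move: hz; rewrite -lerBrDl ler_pdivrMr //.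
  have : (d k)%:R <= 1 :> R by case: (d k); rewrite ?ler01.
  lra.
(* All sequences start from the same [n] and [m], so their points can be compared level by level. *)
have /choice[f hf] d := digit_expansion epsilon zeta d m n e0 z1 (hd d).
apply: (card_le_inj _ _ f) => [d d' _ _ dd'|_ [d _ <-]].
  apply/funext; apply: (digit_expansion_inj epsilon zeta _ _ m n (f d) e2) => //.
  by rewrite dd'.
have [|d0 ?] := nm (f d); first by rewrite -[n]addn0; exact: (hf d 0%N).
by split; [exact: varpi_near_int (hf d) | rewrite /= in_itv].
Qed.

Lemma real_card_le_varpi_itv {R : realType} (epsilon zeta a b : R) :
  0 < epsilon -> 1 < zeta -> 1 + 1 / epsilon <= zeta -> a < b ->
  ([set: R] #<= varpi epsilon zeta `&` `]a, b[)%card.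
Proof.
move=> e0 z1 hz ab; have [e2|e2] := ltP epsilon (1 / 2).
  by apply: real_card_le_varpi_itv_lt_half => //; rewrite e0.
rewrite varpi_half_le //.
(* The target is now the set of nonzero reals in []a, b[]. It contains the corresponding set for the
   sample parameters [1 / 4] and [5 = 1 + 1 / (1 / 4)], to which the previous case applies. *)
have : ([set: R] #<= varpi (1 / 4) 5 `&` `]a, b[)%card.
  by apply: real_card_le_varpi_itv_lt_half => //; lra.
by move/card_le_trans; apply; apply: subset_card_le => x [[]].
Qed.

Theorem theorem3p8 (R : realType) (epsilon zeta : R)
    (epsilon_gt0 : 0 < epsilon) (zeta_gt1 : 1 < zeta) :
  (1 + 1 / (2 * epsilon) <= zeta -> dense (varpi epsilon zeta)) /\
  (1 + 1 / epsilon <= zeta ->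
    forall a b : R, a < b ->
      (varpi epsilon zeta `&` `]a, b[ #= [set: R])%card).
Proof.
split=> [hz O [x Ox] oO|hz a b ab].
  have /nbhs_ballP[r /= r0 xrO] : nbhs x O by exact: open_nbhs_nbhs.
  have [|alpha valpha /andP[? ?]] :=
    varpi_meets_itv epsilon zeta (x - r) (x + r) epsilon_gt0 zeta_gt1 hz.
    by lra.
  exists alpha; split=> //; apply: xrO.
  by rewrite /ball /= ltr_norml; apply/andP; split; lra.
(* By Schröder-Bernstein, two inequalities suffice; one is inclusion in the reals. *)
rewrite card_eq_le; apply/andP; split; last exact: real_card_le_varpi_itv.
exact: subset_card_le.
Qed.
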